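(* For any $\varepsilon>0$ there exists a finite metric tree $T$ and a closed subset $X\subseteq T$ such that $d_{\mathrm{GH}}(T,X)\le \varepsilon\cdot d_{\mathrm{H}}(T,X)$.
   Context: A finite metric graph is a connected metric space obtained by gluing a finite collection of segments $[0,l]$ (the edges, $l$ being the length of the edge) along their endpoints to a finite set of vertices, equipped with the quotient (shortest-path) metric. A finite metric tree is a finite metric graph containing no simple loop (no subset homeomorphic to a circle). The subset $X\subseteq T$ carries the metric restricted from $T$. $d_{\mathrm{H}}$ is the Hausdorff distance between subsets of $T$ and $d_{\mathrm{GH}}$ is the Gromov--Hausdorff distance between metric spaces (one half of the infimum of distortions of correspondences). *)

(* Defs.v *)
From HB Require Import structures.
From Stdlib Require Import Relations.
From mathcomp Require Import all_boot all_order all_algebra.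
From mathcomp Require Import all_classical all_reals all_analysis.
Set Implicit Arguments.
Unset Strict Implicit.
Unset Printing Implicit Defensive.
Import Order.TTheory GRing.Theory Num.Theory.
Import numFieldNormedType.Exports.
Local Open Scope classical_set_scope.
Local Open Scope ring_scope.

(* Loops and multiple edges are allowed. *)
Record gluing_data (R : realType) := GluingData {
  vertex : finType;
  edge : finType;
  src : edge -> vertex;
  tgt : edge -> vertex;
  len : edge -> R;
  len_gt0 : forall e, 0 < len e }.

Section FiniteMetricGraph.
Variables (R : realType) (G : gluing_data R).

(* A point of the disjoint union of the vertices and of the segments
   [0, len e] is either [inl v] or [inr (e, t)] with [0 <= t <= len e]. *)
Definition disjoint_union : set (vertex G + edge G * R) :=
  [set p | match p with inl _ => True | inr (e, t) => 0 <= t <= len e end].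

Inductive glue_step : relation (vertex G + edge G * R) :=
| glue_src e : glue_step (inr (e, 0)) (inl (src e))
| glue_tgt e : glue_step (inr (e, len e)) (inl (tgt e)).

Definition glue : relation (vertex G + edge G * R) :=
  clos_refl_sym_trans _ glue_step.

(* [chain q x y l]: one can go from [x] to [y] by finitely many moves, each of
   them inside the image of a single segment, of total length [l]. *)
Inductive chain (T : Type) (q : vertex G + edge G * R -> T) :
    T -> T -> R -> Prop :=
| chain_refl x : chain q x x 0
| chain_step e s t y l :
    0 <= s <= len e -> 0 <= t <= len e -> chain q (q (inr (e, t))) y l ->
    chain q (q (inr (e, s))) y (`|s - t| + l).

(* [q] presents [T] as the quotient of the disjoint union by [glue], with the
   quotient metric.  The values of [q] outside [disjoint_union] are junk. *)
Definition gluing_map (T : metricType R)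
    (q : vertex G + edge G * R -> T) : Prop :=
  [/\ q @` disjoint_union = [set: T],
      forall p p', disjoint_union p -> disjoint_union p' ->
        (q p = q p' <-> glue p p')
    & forall x y : T,
        (mdist x y)%:E = ereal_inf [set l%:E | l in chain q x y]].

End FiniteMetricGraph.

Definition finite_metric_graph (R : realType) (T : metricType R) : Prop :=
  connected [set: T] /\
  exists (G : gluing_data R) (q : vertex G + edge G * R -> T), gluing_map q.

(* The maps are total; only their restrictions to [A] and [B] matter. *)
Definition homeomorphic (S T : topologicalType) (A : set S) (B : set T) :
    Prop :=
  exists (f : S -> T) (g : T -> S),
    [/\ {within A, continuous f} /\ {within B, continuous g},
        f @` A `<=` B, g @` B `<=` A,
        forall x, A x -> g (f x) = x
      & forall y, B y -> f (g y) = y].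

Definition unit_circle (R : realType) : set (R * R) :=
  [set z | z.1 ^+ 2 + z.2 ^+ 2 = 1].

Definition finite_metric_tree (R : realType) (T : metricType R) : Prop :=
  finite_metric_graph T /\
  ~ exists C : set T, homeomorphic (@unit_circle R) C.

Definition dist_to_set (R : realType) (M : metricType R) (x : M) (A : set M) :
    \bar R :=
  ereal_inf [set (mdist x y)%:E | y in A].

Definition hausdorff_dist (R : realType) (M : metricType R) (A B : set M) :
    \bar R :=
  maxe (ereal_sup [set dist_to_set x B | x in A])
       (ereal_sup [set dist_to_set y A | y in B]).

(* Subsets [A] of [M] and [B] of [N] stand for the metric spaces that they are
   for the restricted metrics, so a correspondence is a subset of [A * B]. *)
Definition correspondence (M N : Type) (A : set M) (B : set N) :
    set (set (M * N)) :=
  [set C | fst @` C = A /\ snd @` C = B].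

Definition distortion (R : realType) (M N : metricType R) (C : set (M * N)) :
    \bar R :=
  ereal_sup [set `|mdist p.1.1 p.2.1 - mdist p.1.2 p.2.2|%:E | p in C `*` C].

Definition gromov_hausdorff_dist (R : realType) (M N : metricType R)
    (A : set M) (B : set N) : \bar R :=
  ((2^-1)%:E * ereal_inf [set distortion C | C in correspondence A B])%E.

(* Main.v *)
(* Take the star with n legs of lengths 1, ..., n, and let X be the star without
   its longest leg.  The tip of that leg is at distance n from X, so
   d_H(T, X) >= n; but pushing every leg towards the centre by one unit and
   then onto the next shorter leg maps T onto X and changes distances by at
   most 2, so d_GH(T, X) <= 1. *)

Require Import Defs.
From HB Require Import structures.
From Stdlib Require Import Relations.
From mathcomp Require Import all_boot all_order all_algebra.
From mathcomp Require Import all_classical all_reals all_analysis.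
From mathcomp Require Import lra.
Set Implicit Arguments.
Unset Strict Implicit.
Unset Printing Implicit Defensive.
Import Order.TTheory GRing.Theory Num.Theory.
Import numFieldNormedType.Exports.
Local Open Scope classical_set_scope.
Local Open Scope ring_scope.

(** * Continuity and real-number preliminaries *)

Lemma nonexpansive_continuous (R : numFieldType) (M N : pseudoMetricType R)
    (f : M -> N) :
  (forall x e y, ball x e y -> ball (f x) e (f y)) -> continuous f.
Proof.
move=> fP x; apply/cvg_ballP => e e0; near=> y; apply: fP; near: y.
exact: nbhsx_ballx.
Unshelve. all: by end_near. Qed.

(** Turns continuity within the circle into genuine continuity along a parametrization of a half
    circle, as the intermediate value theorem requires. *)
Lemma within_continuous_comp (S T U : topologicalType) (A : set T)
    (p : S -> T) (f : T -> U) :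
  (forall s, A (p s)) -> continuous p -> {within A, continuous f} ->
  continuous (f \o p).
Proof.
move=> Ap cp /subspace_continuousP cf s.
have pA : p @ s --> within A (nbhs (p s)).
  by move=> B /cp; apply: (@filterS _ (nbhs s)) => t /(_ (Ap t)).
exact: cvg_comp pA (cf _ (Ap s)).
Qed.

(** For [a < b] the midpoint of [Num.max 0 a] and [b] works. Positivity matters because a branch
    function separates points only where it is positive. *)
Lemma between_gt0 (R : realFieldType) (a b : R) :
  a != b -> 0 < a \/ 0 < b ->
  exists c : R, [/\ 0 < c, c != a, c != b & Num.min a b <= c <= Num.max a b].
Proof.
move=> ab ab0; wlog lt_ab : a b ab ab0 / a < b => [W|].
  have [/W|le_ba] := boolP (a < b); first exact.
  have ltba : b < a by rewrite lt_neqAle eq_sym ab leNgt.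
  have [||c [? ? ? ?]] := W b a _ _ ltba; rewrite 1?eq_sym//.
    by case: ab0; [right|left].
  by exists c; split; rewrite // minC maxC.
have b0 : 0 < b by case: ab0 => // /lt_trans; apply.
have m0 : Num.max 0 a < b by rewrite gt_max b0.
have [m1 m2] := midf_lt m0; move: m1; rewrite gt_max => /andP[c0 ca].
exists ((Num.max 0 a + b) / 2).
rewrite c0 (gt_eqF ca) (lt_eqF m2) (min_l (ltW lt_ab)) (max_r (ltW lt_ab)).
by rewrite (ltW ca) (ltW m2).
Qed.

Lemma clamp_nonexpansive (R : realFieldType) (l s t : R) : 0 <= l ->
  `|Num.max 0 (Num.min s l) - Num.max 0 (Num.min t l)| <= `|s - t|.
Proof.
move=> l0; case: (leP s l) => ?; case: (leP t l) => ?;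
  do ?case: (leP 0 _) => ?; do ?case: ger0P => ?; lra.
Qed.

(* The antipodal points (1, 0) and (-1, 0) are not both the centre, and the
   height function of the branch of one of them takes an intermediate positive
   value on each of the two half circles, contradicting injectivity. *)
Lemma no_circle_of_branches (R : realType) (T : topologicalType) (o : T) :
  (forall x, x <> o -> exists g : T -> R, [/\ continuous g, 0 < g x
    & forall y z, 0 < g y -> g y = g z -> y = z]) ->
  ~ exists C : set T, homeomorphic (@unit_circle R) C.
Proof.
move=> branch [C [h [h' [[ch _] _ _ hK _]]]].
have hI x y : unit_circle x -> unit_circle y -> h x = h y -> x = y.
  by move=> /hK {2}<- /hK {2}<- ->.
(* For [t] in [0, pi], [P 1] runs along the upper half circle and [P (-1)] along the lower one, both
   from (1, 0) to (-1, 0). *)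
pose P (s t : R) := (cos t, s * sin t).
have P1 s t : s ^+ 2 = 1 -> unit_circle (P s t).
  by move=> s1; rewrite /unit_circle/= exprMn s1 mul1r cos2Dsin2.
have Pc s : continuous (P s).
  move=> t.
  have ct : cos x @[x --> t] --> cos t by exact: continuous_cos.
  have st : s * sin x @[x --> t] --> s * sin t.
    by apply: cvgM; [exact: cvg_cst|exact: continuous_sin].
  exact: cvg_pair ct st.
have hPc s : s ^+ 2 = 1 -> continuous (h \o P s).
  by move=> s1; apply: within_continuous_comp ch => // t; exact: P1.
have P0 s : P s 0 = (1, 0) by rewrite /P cos0 sin0 mulr0.
have Ppi s : P s pi = (-1, 0) by rewrite /P cospi sinpi mulr0.
have C1 : unit_circle (1 : R, 0 : R).
  by rewrite -(P0 1); apply: P1; rewrite expr1n.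
have CN1 : unit_circle (-1 : R, 0 : R).
  by rewrite -(Ppi 1); apply: P1; rewrite expr1n.
have neq : h (1, 0) <> h (-1, 0).
  by move=> /(hI _ _ C1 CN1) [] ?; lra.
have [g [cg g0 gI]] : exists g : T -> R, [/\ continuous g,
    0 < g (h (1, 0)) \/ 0 < g (h (-1, 0))
    & forall y z, 0 < g y -> g y = g z -> y = z].
  have [e|/branch[g [cg g0 gI]]] := pselect (h (1, 0) = o).
    have /branch[g [cg g0 gI]] : h (-1, 0) <> o by rewrite -e => /esym.
    by exists g; split=> //; right.
  by exists g; split=> //; left.
have gneq : g (h (1, 0)) != g (h (-1, 0)).
  apply/eqP => e; apply: neq.
  by case: g0 => /gI; [|move=> g0; apply/esym]; auto.
have [c [c0 c1 cN1 cb]] := between_gt0 gneq g0.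
have hit s : s ^+ 2 = 1 -> exists2 t, 0 <= t <= pi & g (h (P s t)) = c.
  move=> s1; have [||t] := @IVT R (g \o (h \o P s)) 0 pi c (pi_ge0 R).
  - apply: continuous_subspaceT => t.
    by apply: continuous_comp; [exact: hPc|exact: cg].
  - by rewrite /= P0 Ppi.
  by rewrite in_itv/= => ? ?; exists t.
have s1 : 1 ^+ 2 = 1 :> R by rewrite expr1n.
have sN1 : (-1) ^+ 2 = 1 :> R by rewrite sqrrN expr1n.
have [t /andP[t0 tpi] tc] := hit _ s1.
have [u /andP[u0 upi] uc] := hit _ sN1.
(* Both points have height [c > 0] on one branch, so they coincide. Then [sin t = - sin u] with both
   sines nonnegative forces [sin t = 0]: the point is (1, 0) or (-1, 0), whose heights differ from
   [c]. *)
have : P 1 t = P (-1) u.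
  apply: hI; [exact: P1|exact: P1|].
  by apply: gI; rewrite tc ?uc.
move=> [_]; rewrite mul1r mulN1r => tu.
have st : sin t = 0.
  have := sin_ge0_pi (introT andP (conj t0 tpi)).
  have := sin_ge0_pi (introT andP (conj u0 upi)); lra.
have ct : (cos t - 1) * (cos t + 1) = 0.
  by have := cos2Dsin2 t; rewrite st; nra.
move: tc; rewrite /P st mulr0.
move/eqP: ct; rewrite mulf_eq0 => /orP[]/eqP ct.
- have -> : cos t = 1 by lra.
  by move=> tc; move: c1; rewrite tc eqxx.
- have -> : cos t = -1 by lra.
  by move=> tc; move: cN1; rewrite tc eqxx.
Qed.

(** * The star as a metric space *)

Section Star.
Context (R : realType) (n : nat).

(** Heights other than at [(ord0, 0)] are positive, so the centre has one representative and no
    quotient is taken. The indices give [n.+1] genuine legs, the longest of length [n.+1]. *)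
Definition star_ok (p : 'I_n.+2 * R) : bool :=
  (p == (ord0, 0)) || (0 < p.2 <= p.1%:R).

(* The point at height [t > 0] on the leg of length [i] is [(i, t)]; the leg of
   length [0] consists of the centre only. *)
Record star := Star { star_val : 'I_n.+2 * R; _ : star_ok star_val }.

HB.instance Definition _ := [isSub for star_val].
HB.instance Definition _ := [Choice of star by <:].

Definition leg (x : star) : 'I_n.+2 := (val x).1.
Definition height (x : star) : R := (val x).2.

Lemma star_ok0 : star_ok (ord0, 0).
Proof. by rewrite /star_ok eqxx. Qed.

Definition center : star := Star star_ok0.

(** Out-of-range coordinates default to the centre; [star_map] and [shift] both rely on this. *)
Definition star_pt (i : 'I_n.+2) (t : R) : star := insubd center (i, t).

Lemma star_ptE (i : 'I_n.+2) (t : R) : 0 < t <= i%:R ->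
  (leg (star_pt i t) = i) * (height (star_pt i t) = t).
Proof. by move=> it; rewrite /leg /height val_insubd /star_ok it orbT. Qed.

Lemma star_pt0 (i : 'I_n.+2) (t : R) :
  ~~ (0 < t <= i%:R) -> star_pt i t = center.
Proof.
move=> it; apply: val_inj; rewrite val_insubd /star_ok (negbTE it) orbF.
by case: eqP.
Qed.

Lemma star_eq x y : leg x = leg y -> height x = height y -> x = y.
Proof.
rewrite /leg /height => e1 e2; apply: val_inj.
by rewrite [LHS]surjective_pairing e1 e2 -surjective_pairing.
Qed.

Lemma starP x : x = center \/ 0 < height x <= (leg x)%:R.
Proof.
case: x => p px; case/orP: (px) => [/eqP e|]; last by right.
by left; apply: val_inj.
Qed.

Lemma height_ge0 x : 0 <= height x.
Proof. by case: (starP x) => [->//|/andP[/ltW]]. Qed.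

Lemma height_center x : height x = 0 -> x = center.
Proof. by case: (starP x) => // + x0; rewrite x0 ltxx. Qed.

Lemma leg_center x : leg x = ord0 -> x = center.
Proof.
by case: (starP x) => // + x0; rewrite x0 lt_leAnge => /andP[/andP[_ /negP]].
Qed.

(** The path metric: points of different legs are joined through the centre. The centre has leg
    [ord0] and height 0, so it needs no separate case. *)
Definition star_dist (x y : star) : R :=
  if leg x == leg y then `|height x - height y| else height x + height y.

Lemma star_distxx x : star_dist x x = 0.
Proof. by rewrite /star_dist eqxx subrr normr0. Qed.

Lemma star_dist_eq0 x y : star_dist x y = 0 -> x = y.
Proof.
rewrite /star_dist; case: eqP => [e /normr0_eq0/eqP|_ /eqP].
  by rewrite subr_eq0 => /eqP; exact: star_eq.
rewrite paddr_eq0 ?height_ge0// => /andP[/eqP/height_center->].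
by move=> /eqP/height_center->.
Qed.

Lemma star_distC x y : star_dist x y = star_dist y x.
Proof. by rewrite /star_dist eq_sym distrC (addrC (height x)). Qed.

Lemma star_dist_triangle y x z :
  star_dist x z <= star_dist x y + star_dist y z.
Proof.
have [[hx hy] hz] := (height_ge0 x, height_ge0 y, height_ge0 z).
rewrite /star_dist; case: (eqVneq (leg x) (leg y)) => [->|xy].
  by case: (eqVneq (leg y) (leg z)) => _; do ?case: ger0P => ?; lra.
case: (eqVneq (leg y) (leg z)) => [<-|_].
  by rewrite (negbTE xy); case: ger0P => ?; lra.
by case: eqP => _; do ?case: ger0P => ?; lra.
Qed.

HB.instance Definition _ := @isMetric.Build R star star_dist
  star_distxx star_dist_eq0 star_distC star_dist_triangle.

Lemma star_mdistE (x y : star) : mdist x y = star_dist x y.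
Proof. by []. Qed.

(** * Signed coordinates along the legs, and the absence of circles *)

Definition leg_coord (i : 'I_n.+2) (x : star) : R :=
  if leg x == i then height x else - height x.

(** The coordinate folds the star onto a line: leg [i] becomes a positive segment and all other legs
    are laid on the negative side, which lengthens no path. *)
Lemma leg_coord_nonexpansive i x y :
  `|leg_coord i x - leg_coord i y| <= mdist x y.
Proof.
rewrite star_mdistE /star_dist /leg_coord.
have [hx hy] := (height_ge0 x, height_ge0 y).
case: (eqVneq (leg x) (leg y)) => [->|xy].
  by case: ifP => _; do ?case: ger0P => ?; lra.
case: eqP => [<-|_].
  by rewrite eq_sym (negbTE xy); case: ger0P => ?; lra.
by case: eqP => _; case: ger0P => ?; lra.
Qed.

Lemma leg_coord_continuous i : continuous (leg_coord i).
Proof.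
apply: nonexpansive_continuous => x e y; rewrite ballEmdist => /= xy.
by apply: le_lt_trans xy; exact: leg_coord_nonexpansive.
Qed.

Lemma leg_coord_gt0 i x : 0 < leg_coord i x -> leg x = i.
Proof.
by rewrite /leg_coord; case: eqP => // _; rewrite oppr_gt0 ltNge height_ge0.
Qed.

Lemma leg_coord_inj i x y :
  0 < leg_coord i x -> leg_coord i x = leg_coord i y -> x = y.
Proof.
move=> x0 xy; have y0 : 0 < leg_coord i y by rewrite -xy.
have [xi yi] := (leg_coord_gt0 x0, leg_coord_gt0 y0).
by apply: star_eq; [rewrite xi yi|move: xy; rewrite /leg_coord xi yi eqxx].
Qed.

Lemma star_no_circle : ~ exists C : set star, homeomorphic (@unit_circle R) C.
Proof.
apply: (@no_circle_of_branches _ _ center) => x xo.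
exists (leg_coord (leg x)); split.
- exact: leg_coord_continuous.
- by rewrite /leg_coord eqxx; case: (starP x) => // /andP[].
- exact: leg_coord_inj.
Qed.

(** * The star as a gluing of segments *)

Lemma star_len_gt0 (e : 'I_n.+1) : 0 < e.+1%:R :> R.
Proof. by rewrite ltr0n. Qed.

(** Edge [e] has length [e.+1] and ends at the tip [lift ord0 e], whose index is also [e.+1]; vertex
    [ord0] is the centre. *)
Definition star_graph : gluing_data R :=
  @GluingData R 'I_n.+2 'I_n.+1 (fun=> ord0) (lift ord0) _ star_len_gt0.

(* Truncating [t] at both ends of the edge (below by the default value of
   [star_pt]) makes [star_map] continuous in [t] on all of [R]. *)
Definition star_map (p : vertex star_graph + edge star_graph * R) : star :=
  match p with
  | inl v => star_pt v v%:R
  | inr (e, t) => star_pt (lift ord0 e) (Num.min t e.+1%:R)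
  end.

Lemma star_map_edge (e : 'I_n.+1) (t : R) : 0 < t <= e.+1%:R ->
  (leg (star_map (inr (e, t))) = lift ord0 e) *
  (height (star_map (inr (e, t))) = t).
Proof. by move=> /[dup] et /andP[_ te]; rewrite /= min_l ?star_ptE// lift0. Qed.

Lemma star_map_le0 (e : 'I_n.+1) (t : R) : t <= 0 ->
  star_map (inr (e, t)) = center.
Proof. by move=> t0; rewrite /= star_pt0// lt_min ltNge t0. Qed.

Lemma star_map_vertex (v : 'I_n.+2) :
  (leg (star_map (inl v)) = v) * (height (star_map (inl v)) = v%:R).
Proof.
have [->|v0] := eqVneq v ord0; first by rewrite /= star_pt0 ?ltxx.
have vv : 0 < (v%:R : R) <= v%:R by rewrite ltr0n lt0n v0 lexx.
by rewrite /= !star_ptE.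
Qed.

(** Comparing edges can disagree with comparing legs only at parameter 0, where the point is the
    centre; there [|s - t|] and [s + t] coincide. *)
Lemma star_map_dist (e e' : 'I_n.+1) (s t : R) :
  0 <= s <= e.+1%:R -> 0 <= t <= e'.+1%:R ->
  mdist (star_map (inr (e, s))) (star_map (inr (e', t))) =
  if e == e' then `|s - t| else s + t.
Proof.
move=> /andP[s0 se] /andP[t0 te]; rewrite star_mdistE /star_dist.
have [s_gt0|s_le0] := ltP 0 s; have [t_gt0|t_le0] := ltP 0 t.
- by rewrite !star_map_edge ?s_gt0 ?t_gt0.
- have -> : t = 0 by lra.
  rewrite (@star_map_le0 e')// !star_map_edge ?s_gt0// [_ == _]eq_sym.
  rewrite (negbTE (neq_lift _ _)) !subr0 !addr0.
  by case: eqP => _; rewrite ?ger0_norm.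
- have -> : s = 0 by lra.
  rewrite (@star_map_le0 e)// !star_map_edge ?t_gt0//.
  rewrite (negbTE (neq_lift _ _)) !sub0r !add0r.
  by case: eqP => _; rewrite ?normrN ?ger0_norm.
- have [-> ->] : s = 0 /\ t = 0 by lra.
  rewrite !star_map_le0// eqxx subrr normr0 addr0.
  by case: eqP.
Qed.

Lemma star_map_onto (x : star) : exists (e : 'I_n.+1) (t : R),
  0 <= t <= e.+1%:R /\ x = star_map (inr (e, t)).
Proof.
have [->|xP] := starP x.
  by exists ord0, 0; rewrite lexx ler0n star_map_le0.
case: (unliftP ord0 (leg x)) => [e le|l0]; last first.
  by case/andP: xP; rewrite l0 => /lt_le_trans/[apply]; rewrite ltxx.
have /andP[x0 xe] : 0 < height x <= e.+1%:R by move: xP; rewrite le lift0.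
exists e, (height x); rewrite xe (ltW x0); split=> //.
by apply: star_eq; rewrite star_map_edge ?x0.
Qed.

Lemma star_map_glue (p p' : vertex star_graph + edge star_graph * R) :
  Defs.disjoint_union p -> Defs.disjoint_union p' ->
  (star_map p = star_map p' <-> Defs.glue p p').
Proof.
have src e : Defs.glue (G := star_graph) (inr (e, 0)) (inl ord0).
  by apply: rst_step; exact: (@glue_src _ star_graph e).
have gsym a b : Defs.glue (G := star_graph) a b -> Defs.glue b a.
  exact: rst_sym.
have gtrans a b c :
    Defs.glue (G := star_graph) a b -> Defs.glue b c -> Defs.glue a c.
  exact: rst_trans.
have vert v e t : 0 <= t <= (e : 'I_n.+1).+1%:R ->
    star_map (inl v) = star_map (inr (e, t)) ->
    Defs.glue (G := star_graph) (inl v) (inr (e, t)).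
  move=> /andP[t0 te] eqm.
  have ev := congr1 leg eqm; have eh := congr1 height eqm.
  move: ev eh; rewrite !star_map_vertex.
  have [t_gt0|t_le0] := ltP 0 t.
    rewrite !star_map_edge ?t_gt0// => -> <-; apply: gsym; rewrite lift0.
    by apply: rst_step; exact: (@glue_tgt _ star_graph e).
  have -> : t = 0 by lra.
  by rewrite star_map_le0// => -> _; exact: gsym.
move=> pD p'D; split.
  case: p pD => [v|[e s]] pD; case: p' p'D => [w|[e' t]] p'D.
  - move=> /(congr1 leg); rewrite (star_map_vertex v) (star_map_vertex w) => ->.
    exact: rst_refl.
  - exact: vert.
  - by move=> /esym/(vert _ _ _ pD)/gsym.
  - move=> /[dup] eqm /(congr1 leg) ev.
    case/andP: (pD) => s0 se; case/andP: (p'D) => t0 te.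
    (* Distance zero means either the same edge with equal parameters, or both parameters zero, that
       is, two sources glued to the centre. *)
    have := star_map_dist pD p'D; rewrite eqm mdistxx.
    case: eqP => [<- /esym/normr0_eq0/eqP|_ /esym/eqP].
      by rewrite subr_eq0 => /eqP <-; exact: rst_refl.
    rewrite paddr_eq0// => /andP[/eqP-> /eqP->].
    exact: gtrans (src _) (gsym _ _ (src _)).
elim => {p p' pD p'D} [p p' [e|e]|//|//|p q r _ + _ +]; last 1 first.
- by move=> -> ->.
- rewrite star_map_le0//; apply: esym; apply: leg_center.
  exact: (star_map_vertex ord0).1.
- have ee : 0 < (e.+1%:R : R) <= e.+1%:R by rewrite lexx ltr0n.
  apply: star_eq; rewrite (star_map_edge ee) (star_map_vertex (lift ord0 e))//.
Qed.

(** The triangle inequality bounds every chain from below; the bound is attained by a single move on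
    a common edge, or else by two moves through the centre. *)
Lemma star_map_chain (x y : star) :
  (mdist x y)%:E = ereal_inf [set l%:E | l in chain star_map x y].
Proof.
apply/eqP; rewrite eq_le; apply/andP; split.
  apply: le_ereal_inf_tmp => _ [l xyl <-]; rewrite lee_fin.
  elim: xyl => {x y l} [x|e s t y l sP tP _ IH]; first by rewrite mdistxx.
  apply: le_trans (metric_triangle _ (star_map (inr (e, t))) _) _.
  by rewrite lerD// star_map_dist// eqxx.
apply: ereal_inf_lbound; exists (mdist x y) => //.
have [e [s [sP ->]]] := star_map_onto x.
have [e' [t [tP ->]]] := star_map_onto y.
rewrite star_map_dist//; case: (eqVneq e e') tP => [<-|_] tP.
  rewrite -[X in chain _ _ _ X]addr0.
  by apply: (@chain_step _ star_graph) => //; exact: (@chain_refl _ star_graph).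
have z (i : 'I_n.+1) : 0 <= (0 : R) <= i.+1%:R by rewrite lexx ler0n.
have [/andP[s0 _] /andP[t0 _]] := (sP, tP).
have -> : s + t = `|s - 0| + (`|0 - t| + 0).
  by rewrite subr0 sub0r normrN !ger0_norm// addr0.
apply: (@chain_step _ star_graph) => //; first exact: (z e).
(* The centre is rewritten from the start of edge [e] to the start of [e'], so that the next move
   can use [e']. *)
rewrite (star_map_le0 e (lexx 0)) -(star_map_le0 e' (lexx 0)).
apply: (@chain_step _ star_graph) => //; first exact: (z e').
exact: (@chain_refl _ star_graph).
Qed.

Lemma star_gluing : gluing_map star_map.
Proof.
split; [|exact: star_map_glue|exact: star_map_chain].
apply/seteqP; split=> // x _.
have [e [t [tP ->]]] := star_map_onto x.
by exists (inr (e, t)).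
Qed.

(** Clamping the parameter to the segment does not change the point and expands no distance, and on
    the segment the map is an isometry. *)
Lemma star_map_edge_continuous (e : 'I_n.+1) :
  continuous (fun t : R => star_map (inr (e, t))).
Proof.
pose clamp (t : R) := Num.max 0 (Num.min t e.+1%:R).
have clampP t : 0 <= clamp t <= e.+1%:R.
  by rewrite le_max lexx ge_max ler0n ge_min lexx orbT.
have star_map_clamp t : star_map (inr (e, t)) = star_map (inr (e, clamp t)).
  have [t0|t0] := leP t 0.
    by rewrite !star_map_le0// /clamp ge_max lexx ge_min t0.
  by rewrite /= /clamp max_r ?le_min ?ler0n ?(ltW t0)// -minA minxx.
apply: nonexpansive_continuous => s d t st.
have {}st : `|s - t| < d by exact: st.
rewrite ballEmdist/= -!/(star_map (inr (e, _))) (star_map_clamp s).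
rewrite (star_map_clamp t) star_map_dist// eqxx.
by apply: le_lt_trans st; exact: clamp_nonexpansive.
Qed.

(** The star is a union of images of segments that all contain the centre. *)
Lemma star_connected : connected [set: star].
Proof.
have -> : [set: star] = \bigcup_(e in [set: 'I_n.+1])
    [set star_map (inr (e, t)) | t in `[0, e.+1%:R]].
  apply/seteqP; split=> // x _.
  have [e [t [tP ->]]] := star_map_onto x.
  by exists e => //; exists t => //=; rewrite in_itv.
apply: bigcup_connected.
  exists center => e _; exists 0; last by rewrite star_map_le0.
  by rewrite /= in_itv/= lexx ler0n.
move=> e _; apply: connected_continuous_connected.
  exact: segment_connected.
by apply: continuous_subspaceT; exact: star_map_edge_continuous.
Qed.

Lemma star_tree : finite_metric_tree star.
Proof.
split; last exact: star_no_circle.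
split; first exact: star_connected.
by exists star_graph, star_map; exact: star_gluing.
Qed.

(** * The trunk and its Hausdorff distance from the star *)

Lemma closed_off_leg (i : 'I_n.+2) : i != ord0 -> closed [set x | leg x != i].
Proof.
move=> i0.
have -> : [set x | leg x != i] = leg_coord i @^-1` [set t | t <= 0].
  apply/seteqP; split=> x /=.
    by rewrite /leg_coord => /negbTE->; rewrite oppr_le0 height_ge0.
  apply: contraTneq => xi; rewrite /leg_coord xi eqxx -ltNge.
  by case: (starP x) => [xo|/andP[]//]; move: i0; rewrite -xi xo.
apply: closed_comp; last exact: closed_le.
by move=> x _; exact: leg_coord_continuous.
Qed.

(** The centre stays in the trunk, since its leg is [ord0] and [ord_max] is [n.+1]. *)
Definition trunk : set star := [set x | leg x != ord_max].

(** Reaching a trunk point [y] from the tip of the longest leg goes through the centre, so the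
    distance is [n.+1] plus the height of [y]. *)
Lemma hausdorff_dist_trunk :
  ((n.+1%:R)%:E <= hausdorff_dist [set: star] trunk)%E.
Proof.
rewrite /hausdorff_dist le_max; apply/orP; left.
have tip : 0 < (n.+1%:R : R) <= (ord_max : 'I_n.+2)%:R by rewrite lexx ltr0n.
apply: le_ereal_sup_tmp; exists (dist_to_set (star_pt ord_max n.+1%:R) trunk).
  by exists (star_pt ord_max n.+1%:R).
apply: le_ereal_inf_tmp => _ [y /= /negbTE yT <-].
rewrite lee_fin star_mdistE /star_dist !(star_ptE tip) eq_sym yT.
by rewrite lerDl height_ge0.
Qed.

(** * The shift of the legs and the Gromov--Hausdorff distance *)

Definition shift (x : star) : star := star_pt (inord (leg x).-1) (height x - 1).

Lemma shiftP x :
  if height x <= 1 then shift x = center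
  else [/\ (leg (shift x)).+1 = leg x :> nat & height (shift x) = height x - 1].
Proof.
have ltl : ((leg x).-1 < n.+2)%N by rewrite (leq_ltn_trans (leq_pred _)).
case: leP => x1.
  by apply: star_pt0; rewrite subr_gt0 ltNge x1.
have [e|/andP[x0 xl]] := starP x; first by move: x1; rewrite e ltNge ler01.
(* A nonzero leg index makes [.-1] a true predecessor, so lowering both the index and the height by
   one respects the length bound. *)
have l0 : (0 < leg x)%N by rewrite -(ltr0n R) (lt_le_trans x0).
have sP : 0 < height x - 1 <= (inord (leg x).-1 : 'I_n.+2)%:R.
  by rewrite subr_gt0 x1 inordK// lerBlDr natr1 prednK.
by rewrite /shift !(star_ptE sP) inordK// prednK.
Qed.

Lemma shift_trunk x : trunk (shift x).
Proof.
have := shiftP x; rewrite /trunk/=; case: leP => [_ ->//|_ [sl _]].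
by apply/eqP => e; have := ltn_ord (leg x); rewrite -sl e ltnn.
Qed.

(** Raise the leg index and the height by one: there is a next leg because [y] avoids the longest
    one. The centre is its own preimage. *)
Lemma shift_onto y : trunk y -> exists x, shift x = y.
Proof.
rewrite /trunk/= => yT.
have [->|/andP[y0 yl]] := starP y.
  by exists center; have := shiftP center; rewrite ler01.
have lt_y : ((leg y).+1 < n.+2)%N.
  rewrite ltn_neqAle ltn_ord andbT.
  by apply: contra yT => /eqP[e]; apply/eqP/val_inj.
have xP : 0 < height y + 1 <= (inord (leg y).+1 : 'I_n.+2)%:R.
  by rewrite inordK// -natr1 lerD2r yl addr_gt0.
exists (star_pt (inord (leg y).+1) (height y + 1)).
have := shiftP (star_pt (inord (leg y).+1) (height y + 1)).
rewrite !(star_ptE xP) inordK// gerDr leNgt y0/= addrK => -[[el] eh].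
by apply: star_eq => //; exact: val_inj.
Qed.

(** Each height drops by at most one, and two points above height 1 share a leg after the shift
    exactly when they did before. *)
Lemma shift_distortion x y :
  `|mdist x y - mdist (shift x) (shift y)| <= 2.
Proof.
have [hx hy] := (height_ge0 x, height_ge0 y).
rewrite !star_mdistE /star_dist.
have h0 : height center = 0 by [].
have := shiftP x; have := shiftP y.
case: leP => [y1 ->|y1 [ly ->]]; case: leP => [x1 ->|x1 [lx ->]].
- rewrite eqxx subrr normr0 subr0.
  by case: eqP => _; do ?case: ger0P => ?; lra.
- by rewrite h0; do 2![case: eqP => _]; do ?case: ger0P => ?; lra.
- by rewrite h0; do 2![case: eqP => _]; do ?case: ger0P => ?; lra.
- have -> : (leg (shift x) == leg (shift y)) = (leg x == leg y).
    by rewrite -!val_eqE/= -lx -ly eqSS.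
  by case: eqP => _; do ?case: ger0P => ?; lra.
Qed.

Lemma gromov_hausdorff_dist_trunk :
  (gromov_hausdorff_dist [set: star] trunk <= 1)%E.
Proof.
pose C := [set (x, shift x) | x in [set: star]].
have CP : correspondence [set: star] trunk C.
  split; apply/seteqP; split=> //.
  - by move=> x _; exists (x, shift x) => //; exists x.
  - by move=> _ [_ [x _ <-] <-]; exact: shift_trunk.
  - by move=> y /shift_onto[x <-]; exists (x, shift x) => //; exists x.
have C2 : (distortion C <= 2%:E)%E.
  apply: ge_ereal_sup => _ [_ [[x _ <-] [y _ <-]] <-].
  by rewrite lee_fin shift_distortion.
have GH : (ereal_inf [set distortion C | C in correspondence [set: star] trunk]
    <= 2%:E)%E.
  by apply: ge_ereal_inf; exists (distortion C) => //; exists C.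
rewrite /gromov_hausdorff_dist.
apply: le_trans (lee_wpmul2l _ GH) _; first by rewrite lee_fin invr_ge0.
by rewrite -EFinM mulVf.
Qed.

End Star.

(** Nonemptiness of [X] and positivity of the Hausdorff distance exclude the degenerate solutions:
    an empty [X], with both sides infinite, and [X = T], with both sides zero. *)
Theorem theorem1 (R : realType) (eps : R) (eps_gt0 : 0 < eps) :
  exists (T : metricType R) (X : set T),
    [/\ finite_metric_tree T,
        closed X,
        X !=set0,
        (0 < hausdorff_dist [set: T] X)%E
      & (gromov_hausdorff_dist [set: T] X
           <= eps%:E * hausdorff_dist [set: T] X)%E].
Proof.
(* This gives [eps^-1 < n.+1], hence [1 <= eps * n.+1], which links the two distance bounds. *)
pose n := Num.truncn eps^-1.
have dH := @hausdorff_dist_trunk R n.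
exists (star R n : metricType R), (@trunk R n); split.
- exact: star_tree.
- exact: closed_off_leg.
- by exists (center R n).
- by apply: lt_le_trans dH; rewrite lte_fin ltr0n.
apply: le_trans (gromov_hausdorff_dist_trunk R n) _.
apply: le_trans (lee_wpmul2l _ dH); last by rewrite lee_fin ltW.
rewrite -EFinM lee_fin -(@ler_pM2l _ eps^-1) ?invr_gt0// mulr1 mulKf ?gt_eqF//.
by rewrite ltW// truncnS_gt.
Qed.
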